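(* Let $G$ be a Lévy group and let $G$ act spatially on a standard Lebesgue probability space $(X,\mathcal{X},\mu)$, i.e. let $G\times X\to X$, $(g,x)\mapsto gx$, be a Borel action of $G$ on the standard Borel space $(X,\mathcal{X})$ such that each $g\in G$ preserves the probability measure $\mu$. Then the action is trivial in the sense that the set of fixed points $\{x\in X: gx=x \text{ for all } g\in G\}$ is of full $\mu$-measure.
   Context: A Polish group is a topological group whose topology is separable and completely metrizable. A Borel action of a Polish group $G$ on a standard Borel space $(X,\mathcal{X})$ is a Borel map $G\times X\to X$, $(g,x)\mapsto gx$, with $ex=x$ and $g(hx)=(gh)x$ for all $g,h\in G$ and all $x\in X$. A spatial $G$-action is a Borel action of $G$ on a standard Borel space $(X,\mathcal{X})$ carrying a probability measure $\mu$ that is preserved by each $g\in G$. Lévy family: a sequence $(X_n,d_n,\mu_n)$, $n=1,2,\dots$, of metric spaces with (Borel) probability measures $\mu_n$ is a Lévy family if for every sequence of (Borel) subsets $A_n\subset X_n$ with $\liminf_n \mu_n(A_n)>0$ and every $\varepsilon>0$ one has $\lim_n\mu_n(B_\varepsilon(A_n))=1$, where $B_\varepsilon(A)$ is the $\varepsilon$-neighborhood of $A$. Lévy group: a Polish group $G$ is a Lévy group if there exist compact subgroups $K_1\subset K_2\subset\cdots$ of $G$ such that $\bigcup_{n}K_n$ is dense in $G$ and $(K_n,d,m_n)$ is a Lévy family, where $m_n$ is the normalized Haar measure on $K_n$ and $d$ is a right-invariant compatible metric on $G$ (the choice of $d$ does not matter). *)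

(* Defs.v *)
From HB Require Import structures.
From mathcomp Require Import all_boot all_order all_algebra.
From mathcomp Require Import all_classical all_reals all_analysis.

Set Implicit Arguments.
Unset Strict Implicit.
Unset Printing Implicit Defensive.

Import Order.TTheory GRing.Theory Num.Theory.

Local Open Scope classical_set_scope.
Local Open Scope ring_scope.

(* [g_sigma_algebraType], hence [borel], only yields a measurableType on pointed
   types; this is why pointed topological spaces are used below. *)
Notation borel T := (g_sigma_algebraType (@open T)).

(* Topological groups, not necessarily abelian; the group law is the
   multiplicative [*%g] of groupType. The base point is unconstrained. *)
HB.mixin Record isTopologicalGroup G
    & PointedTopological G & Group G := {
  mulg_continuous : continuous (fun p : G * G => (p.1 * p.2)%g) ;
  invg_continuous : continuous (fun x : G => (x^-1)%g)
}.

#[short(type="topologicalGroupType")]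
HB.structure Definition TopologicalGroup :=
  {G of PointedTopological G & Group G & isTopologicalGroup G}.

Record subgroup (G : groupType) := Subgroup {
  subgroup_set :> set G ;
  subgroup1 : subgroup_set 1%g ;
  subgroupM : forall x y,
    subgroup_set x -> subgroup_set y -> subgroup_set (x * y)%g ;
  subgroupV : forall x, subgroup_set x -> subgroup_set (x^-1)%g
}.

Definition subgroup_type (G : topologicalGroupType) (H : subgroup G) : Type :=
  set_type H.

Section subgroup_topological_group.
Variables (G : topologicalGroupType) (H : subgroup G).
Local Notation HT := (subgroup_type H).

HB.instance Definition _ := Topological.copy HT (set_type H).

Definition sg_val (x : HT) : G := set_val x.

Let sgP (x : HT) : subgroup_set H (sg_val x). Proof. exact: set_valP. Qed.

Definition sg_mk (x : G) (Hx : subgroup_set H x) : HT := SigSub (mem_set Hx).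

Let sg_inj : injective sg_val. Proof. exact: val_inj. Qed.

Definition sg_one : HT := sg_mk (subgroup1 H).
Definition sg_mul (x y : HT) : HT := sg_mk (subgroupM (sgP x) (sgP y)).
Definition sg_inv (x : HT) : HT := sg_mk (subgroupV (sgP x)).

Let sg_mulA : associative sg_mul.
Proof. by move=> x y z; apply: sg_inj; exact: mulgA. Qed.
Let sg_mul1 : left_id sg_one sg_mul.
Proof. by move=> x; apply: sg_inj; exact: mul1g. Qed.
Let sg_mulV : left_inverse sg_one sg_inv sg_mul.
Proof. by move=> x; apply: sg_inj; exact: mulVg. Qed.
Let sg_mulr1 : right_id sg_one sg_mul.
Proof. by move=> x; apply: sg_inj; exact: mulg1. Qed.
Let sg_mulrV : right_inverse sg_one sg_inv sg_mul.
Proof. by move=> x; apply: sg_inj; exact: mulgV. Qed.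

HB.instance Definition _ := isPointed.Build HT sg_one.
HB.instance Definition _ :=
  isGroup.Build HT sg_mulA sg_mul1 sg_mulr1 sg_mulV sg_mulrV.

Lemma sg_val_continuous : continuous (sg_val).
Proof. exact: initial_continuous. Qed.

Lemma sg_continuousP (T : topologicalType) (f : T -> HT) :
  continuous (sg_val \o f) -> continuous f.
Proof.
move=> /continuousP cf; apply/continuousP => _ [B oB <-].
exact: cf.
Qed.

Let sg_mul_continuous : continuous (fun p : HT * HT => (p.1 * p.2)%g).
Proof.
apply: sg_continuousP => p.
apply: (@continuous_comp _ _ _
  (fun q : HT * HT => (sg_val q.1, sg_val q.2)) (fun q : G * G => (q.1 * q.2)%g)).
  apply: cvg_pair => /=; apply: continuous_comp; try exact: sg_val_continuous.
    exact: cvg_fst.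
  exact: cvg_snd.
exact: mulg_continuous.
Qed.

Let sg_inv_continuous : continuous (fun x : HT => (x^-1)%g).
Proof.
apply: sg_continuousP => x.
apply: (@continuous_comp _ _ _ (sg_val) (fun y : G => (y^-1)%g)).
  exact: sg_val_continuous.
exact: invg_continuous.
Qed.
HB.instance Definition _ :=
  isTopologicalGroup.Build HT sg_mul_continuous sg_inv_continuous.

End subgroup_topological_group.

Record compatible_metric (R : realType) (T : topologicalType)
    (d : T -> T -> R) : Prop := {
  metric_separated : forall x y, d x y = 0 <-> x = y ;
  metric_symmetric : forall x y, d x y = d y x ;
  metric_triangular : forall x y z, d x z <= d x y + d y z ;
  metric_nbhs : forall x (U : set T),
    nbhs x U <-> exists2 e : R, 0 < e & [set y | d x y < e] `<=` U
}.

(* The limit is taken in the topology of T, which is that of d when d is a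
   compatible metric. *)
Definition complete_metric (R : realType) (T : topologicalType)
    (d : T -> T -> R) : Prop :=
  forall u : nat -> T,
    (forall e : R, 0 < e ->
      exists N : nat, forall m n : nat, (N <= m)%N -> (N <= n)%N ->
        d (u m) (u n) < e) ->
    exists l : T, u @ \oo --> l.

Definition separable_space (T : topologicalType) : Prop :=
  exists2 D : set T, countable D & dense D.

Definition polish_space (R : realType) (T : topologicalType) : Prop :=
  separable_space T /\
  exists2 d : T -> T -> R, compatible_metric d & complete_metric d.

(* X is Borel isomorphic to a Polish space, that is, its sigma-algebra is the
   Borel sigma-algebra of some Polish topology. *)
Definition standard_borel (R : realType) (disp : measure_display)
    (X : measurableType disp) : Prop :=
  exists (T : ptopologicalType) (f : X -> borel T) (g : borel T -> X),
    [/\ polish_space R T, cancel f g, cancel g f,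
        measurable_fun [set: X] f & measurable_fun [set: borel T] g].

Definition metric_neighborhood (R : realType) (T : Type) (d : T -> T -> R)
    (e : R) (A : set T) : set T :=
  [set x | exists2 a, A a & d x a < e].

Definition levy_family (R : realType) (X : nat -> ptopologicalType)
    (d : forall n, X n -> X n -> R)
    (mu : forall n, probability (borel (X n)) R) : Prop :=
  (forall n, compatible_metric (d n)) /\
  forall (A : forall n, set (borel (X n))) (e : R),
    (forall n, measurable (A n)) ->
    (0 < limn_einf (fun n => mu n (A n)))%E ->
    0 < e ->
    mu n (metric_neighborhood (d n) e (A n)) @[n --> \oo] --> 1%E.

(* Left invariance; on compact metrizable groups such a probability measure
   exists, is unique, and is also right invariant. *)
Definition haar_probability (R : realType) (H : topologicalGroupType)
    (m : probability (borel H) R) : Prop :=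
  forall (h : H) (A : set (borel H)), measurable A ->
    m ((fun x : H => (h * x)%g) @^-1` A) = m A.

Definition right_invariant (R : realType) (G : groupType)
    (d : G -> G -> R) : Prop :=
  forall x y g, d (x * g)%g (y * g)%g = d x y.

(* The metric is quantified existentially: any two right-invariant compatible
   metrics on G are uniformly equivalent, so they define the same Levy families. *)
Definition levy_group (R : realType) (G : topologicalGroupType) : Prop :=
  polish_space R G /\
  exists (K : nat -> subgroup G) (d : G -> G -> R)
    (m : forall n, probability (borel (subgroup_type (K n))) R),
    [/\ [/\ forall n, compact (K n : set G),
            forall n, (K n : set G) `<=` K n.+1 &
            dense (\bigcup_n (K n : set G))],
        compatible_metric d, right_invariant d,
        forall n, haar_probability (m n) &
        levy_family (X := fun n => subgroup_type (K n))
          (fun n x y => d (sg_val x) (sg_val y)) m].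

Record borel_action (G : topologicalGroupType) (disp : measure_display)
    (X : measurableType disp) (act : G -> X -> X) : Prop := {
  action_measurable :
    measurable_fun [set: borel G * X] (fun p : borel G * X => act p.1 p.2) ;
  action1 : forall x, act 1%g x = x ;
  actionM : forall g h x, act g (act h x) = act (g * h)%g x
}.

Record spatial_action (R : realType) (G : topologicalGroupType)
    (disp : measure_display) (X : measurableType disp) (mu : probability X R)
    (act : G -> X -> X) : Prop := {
  spatial_standard_borel : standard_borel R X ;
  spatial_borel_action : borel_action act ;
  spatial_preserving : forall (g : G) (A : set X), measurable A ->
    mu (act g @^-1` A) = mu A
}.

Definition fixed_points (G X : Type) (act : G -> X -> X) : set X :=
  [set x | forall g, act g x = x].

(* Main.v *)
Require Import Defs.
From mathcomp Require Import all_boot all_order all_algebra.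
From mathcomp Require Import all_classical all_reals all_analysis.
From mathcomp Require Import lra.

(* For Borel B in X and r > 0 let E_r be the set of points x such that gx lies
   in B for nonmeagerly many g in the r-ball around 1. It is measurable, and
   right invariance of d gives h E_r in E_{r + d(h,1)}. Concentration in the
   K_n then shows that each k in the union of the K_n maps almost every point
   of E_r into E_{2r}. If gx <> x, choose B from a countable separating family
   and an open W on whose generic elements w one has wx in B and wgx not in B;
   for a in W and k close to a g a^-1, both taken in a countable dense subset
   of the union of the K_n, moving ax by k and then by a g a^-1 k^-1 gives
   agx in E_{3r}, contrary to the choice of W. *)

Set Implicit Arguments.
Unset Strict Implicit.
Unset Printing Implicit Defensive.

Import Order.TTheory GRing.Theory Num.Theory.

Local Open Scope classical_set_scope.
Local Open Scope ring_scope.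

(** * Meager sets *)

Definition meager (T : topologicalType) (A : set T) : Prop :=
  exists F : nat -> set T,
    (forall n, open (F n) /\ dense (F n)) /\ A `<=` \bigcup_n ~` F n.

Definition countable_base (T : topologicalType) (V : nat -> set T) : Prop :=
  (forall n, open (V n)) /\
  forall x U, nbhs x U -> exists n, V n x /\ V n `<=` U.

Definition baire_space (T : topologicalType) : Prop :=
  forall U : set T, open U -> U !=set0 -> ~ meager U.

Section meager.
Variable T : topologicalType.
Implicit Types A B U V : set T.

Lemma meager_sub A B : A `<=` B -> meager B -> meager A.
Proof. by move=> AB [F [odF BF]]; exists F; split => // x /AB /BF. Qed.

Lemma meager_bigcup (A : nat -> set T) :
  (forall n, meager (A n)) -> meager (\bigcup_n A n).
Proof.
move=> /choice[F FP].
(* Codes that decode to no pair get the whole space, whose empty complement adds nothing to the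
   union. *)
exists (fun k => if unpickle k is Some (n, i) then F n i else setT).
split=> [k|x [n _ Anx]].
  case: unpickle => [[n i]|]; first exact: (FP n).1.
  by split; [exact: openT|move=> O [x Ox] _; exists x].
have [i _ Fx] := (FP n).2 x Anx.
by exists (pickle (n, i)) => //=; rewrite pickleK.
Qed.

Lemma meagerU A B : meager A -> meager B -> meager (A `|` B).
Proof.
move=> mA mB; apply: (@meager_sub _
  (\bigcup_n (if n is 0%N then A else B))); last first.
  by apply: meager_bigcup; case.
by move=> x [Ax|Bx]; [exists 0%N|exists 1%N].
Qed.

Lemma meager0 : meager (@set0 T).
Proof.
exists (fun=> setT); split=> // n; split; first exact: openT.
by move=> O [x Ox] _; exists x.
Qed.

Lemma meager_setC_dense U : open U -> dense U -> meager (~` U).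
Proof. by move=> oU dU; exists (fun=> U); split=> // x Ux; exists 0%N. Qed.

End meager.

Lemma meager_preimage (S T : topologicalType) (f : S -> T) (g : T -> S)
    (A : set T) :
  continuous f -> continuous g -> cancel f g -> cancel g f ->
  meager A -> meager (f @^-1` A).
Proof.
move=> cf cg fK gK [F [odF AF]]; exists (fun n => f @^-1` F n).
split=> [n|x /AF[n _ Fx]]; last by exists n.
have [oF dF] := odF n; split; first by apply: open_comp => // x _; exact: cf.
move=> O [x Ox] oO.
have [||t [Ogt Ft]] := dF (g @^-1` O).
- by exists (f x); rewrite /= fK.
- by apply: open_comp => // y _; exact: cg.
- by exists (g t); split=> //=; rewrite gK.
Qed.

(** * The localized Baire property *)

Section category_property.
Variable T : topologicalType.
Variable V : nat -> set T.
Hypothesis bV : countable_base V.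

(* A localized form of the Baire property, directly stable under complements
   and countable unions. *)
Definition somewhere_comeager (A : set T) : Prop :=
  forall U, open U -> ~ meager (A `&` U) ->
    exists W, [/\ open W, W !=set0, W `<=` U & meager (W `\` A)].

Lemma somewhere_comeager_open A : open A -> somewhere_comeager A.
Proof.
move=> oA U oU nm; exists (A `&` U); split.
- exact: openI.
- by apply/set0P/eqP => AU0; apply: nm; rewrite AU0; exact: meager0.
- by move=> x [].
- by apply: (@meager_sub _ _ set0); [move=> x [[]]|exact: meager0].
Qed.

Lemma somewhere_comeager_bigcup (A : nat -> set T) :
  (forall n, somewhere_comeager (A n)) -> somewhere_comeager (\bigcup_n A n).
Proof.
move=> sA U oU nm.
have [n nmn] : exists n, ~ meager (A n `&` U).
  apply: contrapT => /forallNP H; apply: nm; rewrite setI_bigcupl.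
  by apply: meager_bigcup => n; exact: contrapT (H n).
have [W [oW W0 WU mW]] := sA n U oU nmn.
exists W; split => //; apply: meager_sub mW => x [Wx nA].
by split=> // Anx; apply: nA; exists n.
Qed.

(** If no such [W] exists for the complement, then [A] is comeager on base sets whose union [D] is
    dense in [U]. Outside [A], the set [U] is therefore covered by [D] minus [A] and a nowhere dense
    set. *)
Lemma somewhere_comeagerC A :
  somewhere_comeager A -> somewhere_comeager (~` A).
Proof.
move=> sA U oU nm; apply: contrapT => noW; apply: nm.
pose P n := meager (V n `\` A).
pose D := \bigcup_(n in P) V n.
have oD : open D by apply: bigcup_open => n _; exact: bV.1.
have mDA : meager (D `\` A).
  apply: (@meager_sub _ _ (\bigcup_n if `[< P n >] then V n `\` A else set0)).
    by move=> x [[n Pn Vx] nA]; exists n => //; rewrite asboolT.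
  apply: meager_bigcup => n; case: ifPn => [/asboolP//|_]; exact: meager0.
(* Adding the exterior of [U] turns density in [U] into density in the whole space. *)
pose E := D `|` ~` closure U.
have oE : open E.
  by apply: openU => //; apply: closed_openC; exact: closed_closure.
have dE : dense E.
  move=> O [x Ox] oO; apply: contrapT => /set0P/negP/negPn/eqP OE0.
  have OD0 y : O y -> D y -> False.
    by move=> Oy Dy; have : (O `&` E) y by [split=> //; left]; rewrite OE0.
  have clx : closure U x.
    apply: contrapT => ncl.
    by have : (O `&` E) x by [split=> //; right]; rewrite OE0.
  have [y [Uy Oy]] := clx O (open_nbhs_nbhs (conj oO Ox)).
  apply: noW; exists (U `&` O); split.
  - exact: openI.
  - by exists y.
  - by move=> z [].
  - rewrite setDE setCK setIC; apply: contrapT => nmA.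
    have [W [oW [z Wz] WUO mW]] := sA _ (openI oU oO) nmA.
    have [n [Vz VW]] := bV.2 z W (open_nbhs_nbhs (conj oW Wz)).
    apply: (OD0 z); first exact: (WUO _ Wz).2.
    by exists n => //; apply: meager_sub mW => t [/VW].
apply: (@meager_sub _ _ ((D `\` A) `|` ~` E)).
  move=> x [nAx Ux]; have [Dx|nDx] := pselect (D x); first by left.
  by right=> -[//|]; apply; exact: subset_closure.
by apply: meagerU => //; exact: meager_setC_dense.
Qed.

End category_property.

Lemma somewhere_comeager_borel (T : ptopologicalType) (V : nat -> set T)
    (A : set (borel T)) :
  countable_base V -> measurable A -> somewhere_comeager (A : set T).
Proof.
move=> bV; suff : <<s @open T >> `<=` @somewhere_comeager T by exact.
apply: smallest_sub; last by move=> U; exact: somewhere_comeager_open.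
split.
- exact: somewhere_comeager_open open0.
- by move=> B sB; rewrite setTD; exact: (somewhere_comeagerC bV).
- by move=> F sF; exact: somewhere_comeager_bigcup.
Qed.

(** * Measurability of category quantifiers *)

(* Montgomery-Novikov: the category quantifier preserves measurability. *)
Section vaught.
Variables (T : ptopologicalType) (V : nat -> set T).
Hypotheses (bV : countable_base V) (baireT : baire_space T).
Variables (disp : measure_display) (X : measurableType disp).

Let slice (A : set (borel T * X)) (x : X) : set T := [set t : T | A (t, x)].

Let slice_comeager A : measurable A -> forall x, somewhere_comeager (slice A x).
Proof.
move=> mA x; suff : measurable (slice A x : set (borel T)).
  exact: somewhere_comeager_borel bV.
rewrite -[X in measurable X]setTI.
by have := @pair2_measurable _ _ (borel T) X x measurableT A mA.
Qed.

(** Having every open [U] inside the predicate lets the complement step pass to smaller base sets;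
    measurability is carried along so that slices are known to be Borel. *)
Let vaught (A : set (borel T * X)) : Prop :=
  measurable A /\ forall U : set T, open U ->
    measurable [set x | ~ meager (slice A x `&` U)].

Let vaught0 : vaught set0.
Proof.
split=> // U oU; rewrite (_ : [set x | _] = set0)//.
apply/seteqP; split=> // x /=; apply.
by apply: (@meager_sub _ _ set0); [move=> t []|exact: meager0].
Qed.

(** If the complement is nonmeager in [U], it is comeager in some base set inside [U], where [A] is
    then meager. Conversely, by Baire, [A] meager on a nonempty [V n] leaves the complement
    nonmeager there. *)
Let vaughtC A : vaught A -> vaught (~` A).
Proof.
move=> [mA vA]; split=> [|U oU]; first exact: measurableC.
pose I := [set n | V n !=set0 /\ V n `<=` U].
rewrite (_ : [set x | _] =
    \bigcup_(n in I) ~` [set x | ~ meager (slice A x `&` V n)]); last first.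
  apply/seteqP; split=> [x /= nm|x /= [n [Vn0 VU]] /= /contrapT mV mU].
    have sC := @slice_comeager _ (measurableC mA) x.
    have [W [oW [w Ww] WU mW]] := sC U oU nm.
    have [n [Vw VW]] := bV.2 w W (open_nbhs_nbhs (conj oW Ww)).
    exists n; first by split; [exists w|exact: subset_trans WU].
    by move=> /=; apply; apply: meager_sub mW => t [At /VW Wt]; split=> // /(_ At).
  apply: (baireT (bV.1 n) Vn0).
  apply: meager_sub (meagerU mV mU) => t Vt.
  by have [At|nAt] := pselect (slice A x t); [left|right; split => //; exact: VU].
apply: bigcup_measurable => n _; apply: measurableC; exact: vA (bV.1 n).
Qed.

Let vaught_bigcup (F : nat -> set (borel T * X)) :
  (forall n, vaught (F n)) -> vaught (\bigcup_n F n).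
Proof.
move=> vF; split=> [|U oU].
  by apply: bigcup_measurable => n _; exact: (vF n).1.
rewrite (_ : [set x | _] =
    \bigcup_n [set x | ~ meager (slice (F n) x `&` U)]); last first.
  apply/seteqP; split=> [x /= nm|x /= [n _ nm] mU].
    apply: contrapT => H; apply: nm.
    apply: (@meager_sub _ _ (\bigcup_n (slice (F n) x `&` U))).
      by move=> t [[n _ Ft] Ut]; exists n.
    by apply: meager_bigcup => n; apply: contrapT => nm; apply: H; exists n.
  by apply: nm; apply: meager_sub mU => t [Ft Ut]; split=> //; exists n.
by apply: bigcup_measurable => n _; exact: (vF n).2.
Qed.

Let sigma_vaught : sigma_algebra setT vaught.
Proof. by split=> // A vA; rewrite setTD; exact: vaughtC. Qed.

Let vaught_setT B : measurable B -> vaught (setT `*` B).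
Proof.
move=> mB; split=> [|U oU]; first exact: measurableX.
have [[u Uu]|U0] := pselect (U !=set0); last first.
  rewrite (_ : [set x | _] = set0)//; apply/seteqP; split=> // x /=; apply.
  apply: (@meager_sub _ _ set0); last exact: meager0.
  by move=> t [_ Ut]; apply: U0; exists t.
rewrite (_ : [set x | _] = B)//; apply/seteqP; split=> [x /= nm|x /= Bx].
  apply: contrapT => nB; apply: nm.
  by apply: (@meager_sub _ _ set0); [move=> t [[]]|exact: meager0].
move=> mU; apply: (@baireT U) => //; first by exists u.
by apply: meager_sub mU => t Ut.
Qed.

Let vaughtT (A : set (borel T)) : measurable A -> vaught (A `*` setT).
Proof.
suff : <<s @open T >> `<=` [set A | vaught (A `*` setT)] by exact.
apply: smallest_sub.
- split=> /= [|B vB|F vF]; first by rewrite set0X.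
    rewrite (_ : _ `*` _ = ~` (B `*` setT)); first exact: vaughtC.
    apply/seteqP; split=> [[t x] /= [[_ nB] _] [/nB]//|[t x] /= nBt].
    by split=> //; split=> // Bt; exact: nBt.
  rewrite (_ : _ `*` _ = \bigcup_n (F n `*` setT)); first exact: vaught_bigcup.
  apply/seteqP; split=> [[t x] /= [[n _ Ft] _]|[t x] /= [n _ [Ft _]]].
    by exists n.
  by split=> //; exists n.
- move=> O oO /=; split=> [|U oU].
    by apply: measurableX => //; exact: sub_sigma_algebra.
  (* The slice does not depend on [x], so the set is empty or everything. *)
  have [mOU|nmOU] := pselect (meager (O `&` U)).
    rewrite (_ : [set x | _] = set0)//; apply/seteqP; split=> // x /=; apply.
    by apply: meager_sub mOU => t [[Ot _] Ut].
  rewrite (_ : [set x | _] = setT)//; apply/seteqP; split=> // x _ /= mU.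
  by apply: nmOU; apply: meager_sub mU => t [Ot Ut].
Qed.

Lemma measurable_nonmeager (A : set (borel T * X)) (U : set T) :
  measurable A -> open U ->
  measurable [set x | ~ meager ([set t : T | A (t, x)] `&` U)].
Proof.
move=> mA; suff [_] : vaught A by apply.
apply: (@smallest_sub _ _ _ _ sigma_vaught _ _ mA).
move=> _ [|] [B mB <-]; rewrite setTI.
  suff -> : fst @^-1` B = B `*` [set: X] by exact: vaughtT.
  by apply/seteqP; split=> -[t x] //= [].
suff -> : snd @^-1` B = [set: borel T] `*` B by exact: vaught_setT.
by apply/seteqP; split=> -[t x] //= [].
Qed.

End vaught.

(** * Countable bases and Baire category in metric spaces *)

Section compatible_metric.
Variables (R : realType) (T : topologicalType) (d : T -> T -> R).
Hypothesis cd : compatible_metric d.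

Lemma metric_refl x : d x x = 0.
Proof. exact/(metric_separated cd). Qed.

Lemma metric_ge0 x y : 0 <= d x y.
Proof.
have := metric_triangular cd x y x.
by rewrite metric_refl (metric_symmetric cd y x); lra.
Qed.

Lemma nbhs_metric_ball x (e : R) : 0 < e -> nbhs x [set y | d x y < e].
Proof. by move=> e0; apply/(metric_nbhs cd); exists e. Qed.

Lemma open_metric_ball x (e : R) : open [set y | d x y < e].
Proof.
rewrite openE => y /= xy; apply/(metric_nbhs cd); exists (e - d x y).
  by rewrite subr_gt0.
by move=> z /= yz; have := metric_triangular cd x y z; lra.
Qed.

Lemma metric_countable_base : separable_space T ->
  exists V : nat -> set T, countable_base V.
Proof.
move=> [D /countable_injP[f finj] dD].
(* By injectivity of [f] at most one [t] has code [i], so [W i j] is a single ball or empty; no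
   enumeration of [D] has to be chosen. *)
pose W i j := \bigcup_(t in [set t | D t /\ f t = i])
  [set y | d t y < j.+1%:R^-1].
exists (fun k => if unpickle k is Some (i, j) then W i j else set0); split.
  move=> k; case: unpickle => [[i j]|]; last exact: open0.
  by apply: bigcup_open => t _; exact: open_metric_ball.
move=> x U /(metric_nbhs cd)[e e0 eU].
have [j _ jP] := near_infty_natSinv_lt (PosNum (divr_gt0 e0 (ltr0n R 2))).
have := jP j (leqnn j) => /= {jP} je.
have [t [/= xt Dt]] : [set y | d x y < j.+1%:R^-1] `&` D !=set0.
  apply: dD; last exact: open_metric_ball.
  by exists x; rewrite /= metric_refl invr_gt0 ltr0n.
exists (pickle (f t, j)); rewrite pickleK; split.
  by exists t => //=; rewrite metric_symmetric.
move=> y [t' [Dt' ft'] /= t'y]; apply: eU => /=.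
have t't : t' = t by apply: finj; rewrite ?inE.
move: je xt t'y; rewrite t't; set c : R := _^-1.
by have := metric_triangular cd x t y; lra.
Qed.

(** Nested closed balls: the ball of stage [n.+1] lies in [F n] and in the previous ball, and the
    centres converge to a point of [U] in every [F n]. *)
Lemma complete_metric_baire : complete_metric d -> baire_space T.
Proof.
move=> compl U oU [x0 Ux0] [F [odF UF]].
(* A state is a centre with a radius. The guard on the radius makes the relation total, as the
   choice of [step] requires. *)
pose P (n : nat) (s s' : T * R) := 0 < s.2 ->
  [/\ 0 < s'.2, s'.2 <= n.+1%:R^-1 &
      forall y, d s'.1 y <= s'.2 -> d s.1 y < s.2 /\ F n y].
have /choice[step stepP] : forall ns : nat * (T * R),
    exists s', P ns.1 ns.2 s'.
  move=> [n [x r]] /=; have [r0|nr] := pselect (0 < r); last by exists (x, r).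
  have [oF dF] := odF n.
  have [y [/= xy Fy]] : [set y | d x y < r] `&` F n !=set0.
    apply: dF; last exact: open_metric_ball.
    by exists x; rewrite /= metric_refl.
  have : nbhs y ([set y | d x y < r] `&` F n).
    apply: open_nbhs_nbhs; split=> //.
    by apply: openI => //; exact: open_metric_ball.
  move=> /(metric_nbhs cd)[e e0 eB].
  (* Halving [e] keeps the closed ball inside the open [e]-ball. *)
  exists (y, Num.min (e / 2) n.+1%:R^-1) => _ /=; split.
  - by rewrite lt_min divr_gt0//= invr_gt0 ltr0n.
  - by rewrite ge_min lexx orbT.
  - by move=> z; rewrite le_min => /andP[yz _]; apply: eB => /=; lra.
have [r0 r00 r0U] : exists2 r : R, 0 < r & [set y | d x0 y < r] `<=` U.
  by apply/(metric_nbhs cd); exact: open_nbhs_nbhs.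
pose u := fix u n := if n is m.+1 then step (m, u m) else (x0, r0).
have u0 n : 0 < (u n).2.
  by elim: n => [//|n IH] /=; have [] := stepP (n, u n) IH.
have uS n : (u n.+1).2 <= n.+1%:R^-1 /\ forall y,
    d (u n.+1).1 y <= (u n.+1).2 -> d (u n).1 y < (u n).2 /\ F n y.
  by have [] := stepP (n, u n) (u0 n).
have ule n k y : d (u (n + k)%N).1 y <= (u (n + k)%N).2 ->
    d (u n).1 y <= (u n).2.
  elim: k => [|k IH]; first by rewrite addn0.
  by rewrite addnS => /(uS (n + k)%N).2[/ltW + _]; exact: IH.
have uball n m : (n <= m)%N -> d (u n).1 (u m).1 <= (u n).2.
  move=> nm; apply: (ule n (m - n)%N); rewrite subnKC// metric_refl.
  exact: ltW.
have [|l ul] := compl (fun n => (u n).1).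
  move=> e e0.
  have [N _ NP] := near_infty_natSinv_lt (PosNum (divr_gt0 e0 (ltr0n R 2))).
  exists N.+1 => m n Nm Nn.
  have Ne : N.+1%:R^-1 < e / 2 := NP N (leqnn N).
  have := metric_triangular cd (u m).1 (u N.+1).1 (u n).1.
  have := uball _ _ Nm; have := uball _ _ Nn; have := (uS N).1.
  rewrite (metric_symmetric cd (u m).1 (u N.+1).1); move: Ne (u N.+1) => + v.
  by set c : R := N.+1%:R^-1; lra.
have ball_l n : d (u n).1 l <= (u n).2.
  apply/ler_addgt0Pr => e e0.
  have [M _ MP] := ul _ (nbhs_metric_ball l e0).
  have /= := MP (maxn n M) (leq_maxr _ _).
  rewrite (metric_symmetric cd l) => ule'.
  have := metric_triangular cd (u n).1 (u (maxn n M)).1 l.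
  by have := uball _ _ (leq_maxl n M); lra.
have [n _] := UF l (r0U _ ((uS 0%N).2 l (ball_l 1%N)).1).
by apply; exact: ((uS n).2 l (ball_l n.+1)).2.
Qed.

End compatible_metric.

(** * Uniform concentration *)

Lemma measurable_metric_neighborhood (R : realType) (T : ptopologicalType)
    (d : T -> T -> R) (e : R) (A : set T) : compatible_metric d ->
  measurable (metric_neighborhood d e A : set (borel T)).
Proof.
move=> cd; apply: sub_sigma_algebra.
rewrite (_ : metric_neighborhood d e A = \bigcup_(a in A) [set x | d a x < e]).
  by apply: bigcup_open => a _; exact: open_metric_ball.
by apply/seteqP; split=> x [a Aa] /=; rewrite (metric_symmetric cd);
  exists a.
Qed.

(** If it fails, there are counterexamples at arbitrarily large [n]. Completed to a sequence of sets
    of measure at least [c], they contradict the Lévy property. *)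
Lemma levy_family_uniform (R : realType) (X : nat -> ptopologicalType)
    (d : forall n, X n -> X n -> R)
    (mu : forall n, probability (borel (X n)) R) (c e : R) :
  levy_family d mu -> 0 < c -> 0 < e ->
  exists N : nat, forall n, (N <= n)%N -> forall A : set (borel (X n)),
    measurable A -> (c%:E <= mu n A)%E ->
    (mu n (~` metric_neighborhood (d n) e A) <= c%:E)%E.
Proof.
move=> [cd levy] c0 e0; apply: contrapT => /forallNP H.
pose bad n (A : set (borel (X n))) := [/\ measurable A, (c%:E <= mu n A)%E &
  ~ (mu n (~` metric_neighborhood (d n) e A) <= c%:E)%E].
have badN N : exists2 n, (N <= n)%N & exists A, @bad n A.
  move: (H N) => /existsNP[n /not_implyP[Nn /existsNP[A]]].
  by move=> /not_implyP[mA /not_implyP[cA nA]]; exists n => //; exists A.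
(* This makes [setT] an admissible choice at indices without a counterexample. *)
have c1 : c <= 1.
  have [n _ [A [mA cA _]]] := badN 0%N.
  by rewrite -lee_fin; apply: le_trans cA _; exact: probability_le1.
have badA : forall n, exists A : set (borel (X n)),
    [/\ measurable A, (c%:E <= mu n A)%E & (exists B, @bad n B) -> @bad n A].
  move=> n; have [[B bB]|nB] := pselect (exists B, @bad n B).
    by exists B; have [] := bB.
  by exists setT; split => //; rewrite probability_setT lee_fin.
pose A n := projT1 (cid (badA n)).
have mA n : measurable (A n) by rewrite /A; case: cid => ? [].
have cA n : (c%:E <= mu n (A n))%E by rewrite /A; case: cid => ? [].
have badAn n : (exists B, @bad n B) -> bad n (A n).
  by rewrite /A; case: cid => ? [].
have liminf : (0 < limn_einf (fun n => mu n (A n)))%E.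
  rewrite limn_einf_lim; apply: (@lt_le_trans _ _ c%:E); first by rewrite lte_fin.
  apply: lime_ge; first exact: is_cvg_einfs.
  by near=> n; apply: le_ereal_inf_tmp => _ [m _ <-]; exact: cA.
have lt1 : ((1 - c)%:E < 1 :> \bar R)%E by rewrite lte_fin ltrBlDr ltrDl.
have nb1 : nbhs (1%E : \bar R) [set y | ((1 - c)%:E < y)%E].
  by apply: open_nbhs_nbhs; split=> //; exact: open_ereal_gt_ereal.
have [N _ NP] := levy A e mA liminf e0 _ nb1.
have [n Nn /badAn[_ _]] := badN N.
apply; rewrite probability_setC; last exact: measurable_metric_neighborhood.
have := NP n Nn; rewrite /=.
have mB := measurable_metric_neighborhood e (A n) (cd n).
rewrite -(fineK (fin_num_measure (mu n) _ mB)) -EFinB lte_fin lee_fin.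
lra.
Unshelve. all: by end_near. Qed.

(** * Borel actions and concentration along orbits *)

Lemma borel_measurable_fun (S T : ptopologicalType) (f : S -> T) :
  continuous f -> measurable_fun [set: borel S] (f : borel S -> borel T).
Proof.
move=> cf; apply: (@measurability _ _ (borel S) (borel T) setT f (@open T)) => //.
move=> _ [W oW <-]; rewrite setTI; apply: sub_sigma_algebra.
by apply: open_comp => // x _; exact: cf.
Qed.

Lemma mulg_continuousl (G : topologicalGroupType) (g : G) :
  continuous (fun x : G => (g * x)%g).
Proof.
move=> x; apply: (@continuous_comp _ _ _ (fun x : G => (g, x))
  (fun p : G * G => (p.1 * p.2)%g)); last exact: mulg_continuous.
by apply: cvg_pair => /=; [exact: cvg_cst|exact: cvg_id].
Qed.

Lemma mulg_continuousr (G : topologicalGroupType) (g : G) :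
  continuous (fun x : G => (x * g)%g).
Proof.
move=> x; apply: (@continuous_comp _ _ _ (fun x : G => (x, g))
  (fun p : G * G => (p.1 * p.2)%g)); last exact: mulg_continuous.
by apply: cvg_pair => /=; [exact: cvg_id|exact: cvg_cst].
Qed.

Lemma measurable_action (G : topologicalGroupType) (disp : measure_display)
    (X : measurableType disp) (act : G -> X -> X) (g : G) (A : set X) :
  borel_action act -> measurable A -> measurable (act g @^-1` A).
Proof.
move=> ba mA; have := @measurable_fun_pair2 _ _ _ (borel G) X X _ g
  (action_measurable ba).
by move=> /(_ measurableT A mA); rewrite setTI.
Qed.

Lemma measurable_orbit (G : topologicalGroupType) (disp : measure_display)
    (X : measurableType disp) (act : G -> X -> X) (x : X) (A : set X) :
  borel_action act -> measurable A ->
  measurable [set g : borel G | A (act g x)].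
Proof.
move=> ba mA; have := @measurable_fun_pair1 _ _ _ (borel G) X X _ x
  (action_measurable ba).
by move=> /(_ measurableT A mA); rewrite setTI.
Qed.

(* Averaging over a large [K n] the measure of the points of [A] moved out of
   [S] by [k]: by concentration, for every [x] either few elements of [K n]
   send [x] into [A], or most of them send it into [S]. *)
Lemma levy_orbit (R : realType) (G : topologicalGroupType)
    (disp : measure_display) (X : measurableType disp) (mu : probability X R)
    (act : G -> X -> X) (K : nat -> subgroup G) (d : G -> G -> R)
    (m : forall n, probability (borel (subgroup_type (K n))) R)
    (A S : set X) (e : R) (i : nat) (k : G) :
  borel_action act ->
  (forall g B, measurable B -> mu (act g @^-1` B) = mu B) ->
  (forall n, (K n : set G) `<=` K n.+1) ->
  right_invariant d ->
  (forall n, haar_probability (m n)) ->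
  levy_family (X := fun n => subgroup_type (K n))
    (fun n x y => d (sg_val x) (sg_val y)) m ->
  measurable A -> measurable S -> 0 < e ->
  (forall g x, A x -> d g 1%g < e -> S (act g x)) ->
  (K i : set G) k ->
  mu (A `\` act k @^-1` S) = 0%E.
Proof.
move=> ba mu_act Kmono rd haar levy mA mS e0 AS Kk.
have mD : measurable (A `\` act k @^-1` S).
  by apply: measurableD => //; exact: measurable_action.
set D := A `\` _ in mD *.
apply/eqP; rewrite eq_le measure_ge0 andbT.
apply/lee_addgt0Pr => c c0; rewrite add0e.
have [N NP] := levy_family_uniform levy c0 e0.
(* Large enough both for concentration at level [c] and for [k] to lie in [K n]. *)
pose n := maxn N i.
have Kn : (K n : set G) k.
  have Kle j l : (j <= l)%N -> (K j : set G) `<=` K l.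
    move=> /subnKC <-; elim: (l - j)%N => [|p IH]; first by rewrite addn0.
    by rewrite addnS => x /IH; exact: Kmono.
  exact: Kle (leq_maxr N i) _ Kk.
pose H := subgroup_type (K n).
pose k' : H := sg_mk Kn.
(* By invariance of [mu], each section of [Z] at a group element has measure [mu D]. Fubini then
   reduces the bound to sections at points of [X], each shown to have Haar measure at most [c]. *)
pose Z : set (borel H * X) := [set p | D (act (sg_val (p.1 : H)) p.2)].
have mact' : measurable_fun [set: borel H * X]
    (fun p : borel H * X => act (sg_val (p.1 : H)) p.2).
  apply: (@measurableT_comp _ _ _ (borel H * X)%type (borel G * X)%type X
    (fun p : borel G * X => act p.1 p.2) setT (fun p => (sg_val (p.1 : H), p.2))).
    exact: action_measurable ba.
  apply/measurable_fun_pairP; split; last exact: measurable_snd.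
  apply: (@measurableT_comp _ _ _ (borel H * X)%type (borel H) (borel G)
    (@sg_val _ (K n)) setT fst); last exact: measurable_fst.
  exact: (@borel_measurable_fun H G (@sg_val _ (K n)) (@sg_val_continuous _ _)).
have mZ : measurable Z.
  by rewrite -[X in measurable X]setTI; exact: mact'.
have mA' x : measurable [set h : borel H | A (act (sg_val (h : H)) x)].
  have := @measurable_fun_pair1 _ _ _ (borel H) X X _ x mact'.
  by move=> /(_ measurableT A mA); rewrite setTI.
have := indic_fubini_tonelli (m n) mu mZ.
rewrite indic_fubini_tonelli_FE// indic_fubini_tonelli_GE//.
rewrite (eq_integral (cst (mu D))); last first.
  move=> h _ /=.
  rewrite -(mu_act (sg_val (h : H)) D mD); congr (mu _).
  by rewrite xsectionE.
rewrite integral_cst// [X in (_ * X)%E](_ : _ = 1%E); last exact: (probability_setT (m n)).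
rewrite mule1 => ->.
apply: (@le_trans _ _ (\int[mu]_x (cst c%:E x))%E); last first.
  by rewrite integral_cst// [X in (_ * X)%E](_ : _ = 1%E) ?mule1//; exact: (probability_setT mu).
apply: ge0_le_integral => //.
  exact: measurable_fun_ysection.
move=> x _ /=; rewrite ysectionE.
pose Ax := [set h : borel H | A (act (sg_val (h : H)) x)].
have mZx : measurable (ysection Z x) by exact: measurable_ysection.
rewrite ysectionE in mZx.
have [cA|Ac] := leP c%:E (m n Ax); last first.
  apply: le_trans (ltW Ac); apply: le_measure; rewrite ?inE//; first exact: mA'.
  by move=> h [].
pose B := metric_neighborhood (fun x y : H => d (sg_val x) (sg_val y)) e Ax.
have mB : measurable (~` B : set (borel H)).
  apply: measurableC; apply: measurable_metric_neighborhood; exact: levy.1.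
apply: le_trans (NP n (leq_maxl N i) Ax (mA' x) cA).
(* If [h] sends [x] into [D], then [k' * h] lies outside [B]; left invariance absorbs [k']. *)
rewrite -(haar n k' (~` B) mB); apply: le_measure; rewrite ?inE//.
  rewrite -[X in measurable X]setTI.
  apply: (@borel_measurable_fun H H (fun h => (k' * h)%g)) => //.
  exact: mulg_continuousl.
move=> h [_ nS] [a Aa da]; apply: nS => /=.
rewrite (actionM ba).
(* By right invariance, [k h a^-1] is as close to 1 as [k h] is to [a], so it carries the point of
   [A] at [a] into [S]. *)
have -> : (k * sg_val (h : H) = (k * sg_val (h : H)) * (sg_val a)^-1 * sg_val a)%g.
  by rewrite mulgVK.
rewrite -(actionM ba); apply: (AS _ _ Aa).
by rewrite -(mulgV (sg_val a)) rd.
Qed.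

(** * Nonmeager returns near the identity *)

Lemma meager_translate (G : topologicalGroupType) (h : G) (A : set G) :
  meager A -> meager [set g | A (g * h)%g].
Proof.
apply: (@meager_preimage G G (fun g => (g * h)%g) (fun g => (g * h^-1)%g)).
- exact: mulg_continuousr.
- exact: mulg_continuousr.
- by move=> g; rewrite mulgK.
- by move=> g; rewrite mulgVK.
Qed.

Lemma standard_borel_separating (R : realType) (disp : measure_display)
    (X : measurableType disp) : standard_borel R X ->
  exists2 B : nat -> set X, (forall i, measurable (B i)) &
    forall x y, x <> y -> exists i, B i x /\ ~ B i y.
Proof.
move=> [T [f [g [[sepT [d cd _]] fK _ mf _]]]].
have [V [oV bV]] := metric_countable_base cd sepT.
exists (fun i => f @^-1` V i) => [i|x y xy].
  rewrite -[X in measurable X]setTI; apply: mf => //.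
  exact: sub_sigma_algebra.
have dxy : 0 < d (f x) (f y).
  rewrite lt_def metric_ge0// andbT; apply/eqP.
  by move/(metric_separated cd)/(can_inj fK).
have [i [Vx Vsub]] := bV (f x) _ (nbhs_metric_ball cd (f x) dxy).
by exists i; split=> // /Vsub /=; rewrite ltxx.
Qed.

Section nonmeager_returns.
Variables (R : realType) (G : topologicalGroupType) (disp : measure_display).
Variables (X : measurableType disp) (act : G -> X -> X) (d : G -> G -> R).
Hypotheses (cd : compatible_metric d) (rd : right_invariant d).
Hypothesis ba : borel_action act.
Implicit Types (B : set X) (r e : R) (a h : G) (x : X).

(** This is the Vaught transform of [B] over the [r]-ball around 1. Small group elements move it
    only by enlarging the radius. *)
Definition nonmeager_returns B r : set X :=
  [set x | ~ meager ([set g | B (act g x)] `&` [set g | d g 1%g < r])].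

(** Right translation by [a] preserves meagerness and, being an isometry, carries the ball around 1
    to the ball around [a]. *)
Lemma nonmeager_returns_act B r a x : nonmeager_returns B r (act a x) <->
  ~ meager ([set g | B (act g x)] `&` [set g | d g a < r]).
Proof.
rewrite /nonmeager_returns /=; split=> + m; apply.
  apply: meager_sub (meager_translate a m) => g [/=].
  by rewrite (actionM ba) => Bg dg; split; rewrite //= -(rd _ _ a^-1%g) mulgV mulgK.
apply: meager_sub (meager_translate a^-1%g m) => g [/= Bg dg].
by rewrite (actionM ba) mulgVK -(rd _ _ a) mulgVK mul1g.
Qed.

Lemma nonmeager_returns_shift B r e h x : nonmeager_returns B r x ->
  d h 1%g < e -> nonmeager_returns B (r + e) (act h x).
Proof.
move=> Bx he; apply/nonmeager_returns_act => m; apply: Bx.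
apply: meager_sub m => g [Bg /= g1]; split=> //=.
by have := metric_triangular cd g 1%g h; rewrite (metric_symmetric cd 1%g); lra.
Qed.

Lemma measurable_nonmeager_returns B r :
  separable_space G -> baire_space G ->
  measurable B -> measurable (nonmeager_returns B r).
Proof.
move=> sepG bG mB; have [V bV] := metric_countable_base cd sepG.
apply: (@measurable_nonmeager G V bV bG _ X
  [set p : borel G * X | B (act p.1 p.2)] [set g | d g 1%g < r]).
  by rewrite -[X in measurable X]setTI; exact: (action_measurable ba).
rewrite (_ : [set g | _] = [set g | d 1%g g < r]); first exact: open_metric_ball.
by apply/seteqP; split=> g /=; rewrite (metric_symmetric cd).
Qed.

End nonmeager_returns.

(** Picking a point of [D] in each nonempty base set leaves only countably many group elements,
    hence countably many null sets, to handle. *)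
Lemma dense_sequence (T : topologicalType) (V : nat -> set T) (D : set T) :
  countable_base V -> dense D -> D !=set0 ->
  exists2 q : nat -> T, (forall n, D (q n)) &
    forall W, open W -> W !=set0 -> exists n, W (q n).
Proof.
move=> [oV bV] dD [t Dt].
have /choice[q qP] : forall n, exists y, D y /\ (V n !=set0 -> V n y).
  move=> n; have [V0|V0] := pselect (V n !=set0); last by exists t.
  by have [y [Vy Dy]] := dD _ V0 (oV n); exists y.
exists q => [n|W oW [w Ww]]; first by have [] := qP n.
have [n [Vw VW]] := bV w W (open_nbhs_nbhs (conj oW Ww)).
by exists n; apply: VW; apply: (qP n).2; exists w.
Qed.

(** * Triviality of the action *)

Theorem theorem1p1 (R : realType) (G : topologicalGroupType)
    (disp : measure_display) (X : measurableType disp) (mu : probability X R)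
    (act : G -> X -> X) :
  levy_group R G ->
  spatial_action mu act ->
  {ae mu, forall x, fixed_points act x}.
Proof.
move=> [[sepG [d0 cd0 compl0]] [K [d [m [[cK Kmono dK] cd rd haar levy]]]]].
move=> [sbX ba mu_act].
have [V bV] := metric_countable_base cd sepG.
have bG : baire_space G by exact: complete_metric_baire cd0 compl0.
have [B mB sepB] := standard_borel_separating sbX.
have [q Kq qd] : exists2 q : nat -> G, (forall n, (\bigcup_i (K i : set G)) (q n)) &
    forall W, open W -> W !=set0 -> exists n, W (q n).
  apply: (dense_sequence bV dK).
  by exists 1%g, 0%N => //; exact: subgroup1.
pose E := nonmeager_returns act d.
have mE i r : measurable (E (B i) r).
  exact: (measurable_nonmeager_returns cd ba r sepG bG (mB i)).
(* The extra translate by [q j] is there because the property is later used at [act a x]; invariance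
   of [mu] keeps the exceptional set null. *)
have aeE : {ae mu, forall x, forall j l i n, E (B i) n.+1%:R^-1 (act (q j) x) ->
    E (B i) (n.+1%:R^-1 + n.+1%:R^-1) (act (q l) (act (q j) x))}.
  apply/ae_foralln => j; apply/ae_foralln => l.
  apply/ae_foralln => i; apply/ae_foralln => n.
  have [p _ Kp] := Kq l.
  have n0 : 0 < n.+1%:R^-1 :> R by rewrite invr_gt0 ltr0n.
  have := levy_orbit ba mu_act Kmono rd haar levy (mE i n.+1%:R^-1)
    (mE i (n.+1%:R^-1 + n.+1%:R^-1)) n0 _ Kp.
  move=> /(_ (fun g x Ax dg => nonmeager_returns_shift cd rd ba Ax dg)) mu0.
  have mD : measurable (E (B i) n.+1%:R^-1 `\`
      act (q l) @^-1` E (B i) (n.+1%:R^-1 + n.+1%:R^-1)).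
    by apply: measurableD => //; exact: measurable_action.
  exists (act (q j) @^-1` (E (B i) n.+1%:R^-1 `\`
    act (q l) @^-1` E (B i) (n.+1%:R^-1 + n.+1%:R^-1))); split.
  - exact: measurable_action.
  - exact: etrans (mu_act _ _ mD) mu0.
  - by move=> x /= /not_implyP[].
apply: filterS aeE => x Ex g0; apply: contrapT => gx.
pose y := act g0 x.
pose S i := [set g | B i (act g x)] `\` [set g | B i (act g y)].
(* Since [x] and [y] differ, so do their images under every [g]; hence the sets [S i] cover [G] and
   cannot all be meager. *)
have [i nmS] : exists i, ~ meager (S i `&` setT).
  apply: contrapT => /forallNP H; apply: (bG setT openT); first by exists 1%g.
  apply: (@meager_sub _ _ (\bigcup_i (S i `&` setT))).
    move=> g _; have [|i [Bx nBy]] := sepB (act g x) (act g y).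
      move=> /(congr1 (act g^-1%g)); rewrite !(actionM ba) mulVg !(action1 ba).
      by rewrite mul1g => xy; exact: gx (esym xy).
    by exists i.
  by apply: meager_bigcup => i; exact: contrapT (H i).
have mS : measurable (S i : set (borel G)).
  by apply: measurableD; apply: (measurable_orbit _ ba).
have [W [oW W0 _ mWS]] := somewhere_comeager_borel bV mS openT nmS.
have [j Wa] := qd W oW W0; set a := q j in Wa.
have [e e0 eW] : exists2 e : R, 0 < e & [set g | d a g < e] `<=` W.
  by apply/(metric_nbhs cd); exact: open_nbhs_nbhs.
(* The final radius is [r + r + r]: one [r] to start, one for concentration, one for the error in
   approximating by [q l]. *)
have [n _ nP] := near_infty_natSinv_lt (PosNum (divr_gt0 e0 (ltr0n R 3))).
have := nP n (leqnn n) => /= {nP}.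
move: Ex => /(_ j _ i n); rewrite -/a.
have : 0 < n.+1%:R^-1 :> R by rewrite invr_gt0 ltr0n.
set r : R := n.+1%:R^-1 => r0 Ex re.
have Eax : E (B i) r (act a x).
  apply/(nonmeager_returns_act rd ba) => mAx.
  apply: (bG _ (open_metric_ball cd a r) _ _).
    by exists a; rewrite /= (metric_refl cd).
  apply: meager_sub (meagerU mAx mWS) => g /= ag.
  have Wg : W g by apply: eW => /=; lra.
  have [[Bx _]|nSg] := pselect (S i g); last by right.
  by left; split=> //=; rewrite (metric_symmetric cd).
(* The element [a g0 a^-1] takes [act a x] to [act a y]; [q l] approximates it within the dense
   sequence. *)
have [||l /= al] := qd [set g | d (a * g0 * a^-1)%g g < r].
- exact: open_metric_ball.
- by exists (a * g0 * a^-1)%g; rewrite /= (metric_refl cd).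
have kr : d (a * g0 * a^-1 * (q l)^-1)%g 1%g < r.
  by rewrite -(mulgV (q l)) rd.
have := nonmeager_returns_shift cd rd ba (Ex l Eax) kr.
rewrite !(actionM ba) !mulgVK -(actionM ba).
move=> /(nonmeager_returns_act rd ba); apply.
(* Elements [g] within [3r] of [a] lie in [W], and those sending [y] into [B i] lie outside [S i],
   so they form a meager set. *)
apply: meager_sub mWS => g [/= Bgy ga]; split; last by case.
by apply: eW => /=; rewrite (metric_symmetric cd); lra.
Qed.
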